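(* Let $G$ be a finite graph whose vertex set can be partitioned into four parts such that three of them induce cliques in $G$ and the fourth one splits into two sets, each inducing a clique in $G$, with no edge of $G$ running between these two sets. Then $G$ is a string graph.
   Context: A curve is a subset of the plane homeomorphic to $[0,1]$. A string graph is a graph isomorphic to the intersection graph of a finite family of curves in the plane (vertices are the curves, two vertices adjacent iff the curves intersect). *)

(* Defs.v *)
From mathcomp Require Import all_boot all_order all_algebra.
From mathcomp Require Import all_classical all_reals all_analysis.

Set Implicit Arguments.
Unset Strict Implicit.
Unset Printing Implicit Defensive.

Import Order.TTheory GRing.Theory Num.Theory.
Import numFieldNormedType.Exports.

Local Open Scope classical_set_scope.
Local Open Scope ring_scope.

Definition homeomorphic (S T : topologicalType) (A : set S) (B : set T) : Prop :=
  exists (f : S -> T) (g : T -> S),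
    [/\ set_fun A B f, set_fun B A g,
        {in A, cancel f g} & {in B, cancel g f}] /\
    {within A, continuous f} /\ {within B, continuous g}.

(* The plane is [R * R] with the product topology. *)
Definition is_curve (R : realType) (C : set (R * R)) : Prop :=
  homeomorphic (`[0, 1] : set R) C.

(* The vertices of the intersection graph are the curves themselves, so the
   isomorphism [C] is a bijection onto the finite set [F] of curves; in
   particular distinct vertices get distinct curves. *)
Definition is_string_graph (R : realType) (V : finType) (e : rel V) : Prop :=
  exists (F : set (set (R * R))) (C : V -> set (R * R)),
    [/\ finite_set F,
        (forall c, F c -> is_curve c),
        set_bij [set: V] F C &
        forall u v, u != v -> (e u v <-> C u `&` C v !=set0)].

Definition is_clique (V : finType) (e : rel V) (A : {set V}) : Prop :=
  {in A &, forall u v, u != v -> e u v}.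

(* Parts may be empty, unlike in [finset.partition]. *)
Definition is_partition (I V : finType) (P : I -> {set V}) : Prop :=
  (forall i j, i != j -> [disjoint P i & P j]%B) /\
  (forall v, exists i, v \in P i).

(* Main.v *)
Require Import Defs.
From mathcomp Require Import all_boot all_order all_algebra.
From mathcomp Require Import all_classical all_reals all_analysis.
From mathcomp Require Import zify lra.

Set Implicit Arguments.
Unset Strict Implicit.
Unset Printing Implicit Defensive.

Import Order.TTheory GRing.Theory Num.Theory.
Import numFieldNormedType.Exports.

(** Contracting the five cliques [X0], [A], [B], [X1], [X2] yields a subgraph of
    K5 minus the edge [AB], which has a bar visibility drawing: assign to the
    cliques horizontal bars at increasing heights so that any two of them other
    than [A] and [B] see each other along some vertical line.  Every vertex is
    drawn as the graph of a piecewise linear function running along the bar of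
    its clique; two adjacent vertices in different cliques grow spikes that meet
    midway on a line of sight reserved for this pair.  Vertices of one clique
    meet wherever both run along their bar. *)

(** * Graphs of piecewise linear functions as curves *)

Section GraphCurves.
Local Open Scope classical_set_scope.
Local Open Scope ring_scope.

Definition graph_on (R : realType) (f : R -> R) (a b : R) : set (R * R) :=
  [set p | a <= p.1 <= b /\ p.2 = f p.1].

Lemma graph_on_is_curve (R : realType) (f : R -> R) (a b : R) :
  continuous f -> a < b -> is_curve (graph_on f a b).
Proof.
move=> cf ab; have ba0 : 0 < b - a by rewrite subr_gt0.
pose aff (t : R) := a + t * (b - a).
have caff : continuous aff.
  move=> t; apply: cvgD; first exact: cvg_cst.
  by apply: cvgM; [exact: cvg_id | exact: cvg_cst].
exists (fun t => (aff t, f (aff t))), (fun p => (p.1 - a) / (b - a)).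
split; [split|split].
- move=> t /=; rewrite in_itv /= => /andP[t0 t1]; rewrite /graph_on /aff /=.
  by split=> //; apply/andP; split; nra.
- move=> [x y] [/= /andP[ax xb] _]; rewrite in_itv /=.
  by rewrite ler_pdivlMr // mul0r ler_pdivrMr // mul1r; lra.
- by move=> t _; rewrite /aff /= addrC addKr mulfK // gt_eqF.
- move=> [x y]; rewrite inE => -[/= _ ->].
  by rewrite /aff divfK ?gt_eqF // addrC subrK.
- apply: continuous_subspaceT => t.
  exact: (cvg_pair (caff t) (continuous_comp (caff t) (cf (aff t)))).
- apply: continuous_subspaceT => p; apply: cvgM; last exact: cvg_cst.
  by apply: cvgB; [exact: cvg_fst | exact: cvg_cst].
Qed.

Definition hat (R : realType) (x : R) : R := Num.max 0 (1 - `|x|).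

(** Piecewise linear interpolation at the integers [k < M], written in the basis of tent functions;
    past the last node it falls to 0. *)
Definition interp (R : realType) (M : nat) (g : nat -> nat) (x : R) : R :=
  \sum_(k < M) (g k)%:R * hat (x - k%:R).

Lemma hat_ge0 (R : realType) (x : R) : 0 <= hat x.
Proof. by rewrite /hat le_max lexx. Qed.

Lemma hat_gt0 (R : realType) (x : R) : (0 < hat x) = (`|x| < 1).
Proof. by rewrite /hat lt_max ltxx subr_gt0. Qed.

Lemma continuous_interp (R : realType) (M : nat) (g : nat -> nat) :
  continuous (@interp R M g).
Proof.
move=> x; apply: cvg_big => [|k _]; first exact: add_continuous.
apply: cvgM; first exact: cvg_cst.
apply: (@continuous_max _ _ (fun=> 0) (fun x : R => 1 - `|x - k%:R|)).
  exact: cvg_cst.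
apply: cvgB; first exact: cvg_cst.
by apply: cvg_norm; apply: cvgB; [exact: cvg_id | exact: cvg_cst].
Qed.

Lemma interp_nat (R : realType) (M : nat) (g : nat -> nat) (j : nat) :
  (j < M)%N -> interp M g (j%:R : R) = (g j)%:R.
Proof.
move=> jM; rewrite /interp (bigD1 (Ordinal jM)) //= big1 ?addr0.
  by rewrite subrr /hat normr0 subr0 max_r ?mulr1 // ler01.
move=> k kj; apply/eqP; rewrite mulf_eq0; apply/orP; right.
have {}kj : (k : nat) != j by apply: contra kj => /eqP kj; apply/eqP/val_inj.
rewrite eq_le hat_ge0 andbT leNgt hat_gt0 -leNgt.
have [kltj|jltk|kej] := ltngtP k j; last by rewrite kej eqxx in kj.
- by rewrite ger0_norm ?subr_ge0 ?ler_nat 1?ltnW // lerBrDr nat1r ler_nat.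
- by rewrite ler0_norm ?opprB ?subr_le0 ?ler_nat 1?ltnW // lerBrDr nat1r ler_nat.
Qed.

(** Only nodes at distance less than 1 carry weight at [x]. The node [Num.truncn x] has positive
    weight and gives strictness; the other terms compare weakly. *)
Lemma lt_interp (R : realType) (M : nat) (g h : nat -> nat) (x : R) :
  0 <= x -> x < M%:R ->
  (forall k, `|x - k%:R| < 1 -> (g k < h k)%N) ->
  interp M g x < interp M h x.
Proof.
move=> x0 xM gh; rewrite /interp.
have kM : (Num.truncn x < M)%N.
  by rewrite -(ltr_nat R) (le_lt_trans _ xM) // truncn_le.
rewrite (bigD1 (Ordinal kM)) //= [ltRHS](bigD1 (Ordinal kM)) //=.
apply: ltr_leD.
  have xk : `|x - (Num.truncn x)%:R| < 1.
    rewrite ger0_norm ?subr_ge0 ?truncn_le // ltrBlDr nat1r.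
    exact: truncnS_gt.
  by rewrite ltr_pM2r ?hat_gt0 // ltr_nat gh.
apply: ler_sum => k _; have := hat_ge0 (x - k%:R).
rewrite le_eqVlt => /predU1P[<-|]; first by rewrite !mulr0.
by rewrite hat_gt0 => /gh /ltnW ghk; rewrite ler_wpM2r ?hat_ge0 // ler_nat.
Qed.

End GraphCurves.

(** * String representations from bar visibility drawings *)

Section BarVisibility.
Local Open Scope classical_set_scope.
Local Open Scope ring_scope.

Context (R : realType) (V : finType) (e : rel V).
Context (cls : V -> nat) (lo hi : nat -> nat) (L : nat).

(* [lo c] and [hi c] delimit the slots spanned by bar [c]. *)
Definition active c s := (lo c <= s <= hi c)%N.

Definition clear c d s := all (fun m => ~~ active m s) (iota c.+1 (d - c.+1)).

(* Heights are scaled by 4: bar [c] is at height [4 * c], and spikes of bars [c]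
   and [d] meet at [2 * (c + d)].  The bump to [4 * c + 1] at the node of [(w, w)]
   makes the curves of distinct vertices distinct. *)
Definition spike_height (w : V) (s : nat) (o : option (V * V)) : nat :=
  if o isn't Some (u, v) then (4 * cls w)%N
  else if (u == w) && (v == w) then (4 * cls w).+1
  else if [&& cls u < cls v, e u v, clear (cls u) (cls v) s & w \in [:: u; v]]%N
       then (2 * (cls u + cls v))%N
  else (4 * cls w)%N.

Lemma clear_le c d s m : clear c d s -> (c < m)%N -> active m s -> (d <= m)%N.
Proof.
move=> /allP cl cm ma; rewrite leqNgt; apply/negP => md.
by have := cl m; rewrite ma mem_iota => /(_ _)/negP; apply; lia.
Qed.

(** At the node of a pair [(a, b)] that grows spikes, only [a] and [b] leave their bars, to a height
    strictly between these, and [clear] keeps all other active bars out of that gap. So the order of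
    [u] and [v] could fail only if they were [a] and [b], which are adjacent. A bump by 1 is
    harmless since bars are 4 apart. *)
Lemma spike_height_lt u v s o :
  (cls u < cls v)%N -> ~~ e u v -> active (cls u) s -> active (cls v) s ->
  (spike_height u s o < spike_height v s o)%N.
Proof.
move=> uv euv us vs; rewrite /spike_height.
case: o => [[a b]|]; last lia.
rewrite !inE.
have [ab|ba] := ltnP (cls a) (cls b); last first.
  by case: ifP => _; case: ifP => _; lia.
have [eab|] /= := boolP (e a b); last by case: ifP => _; case: ifP => _; lia.
have [cl|] /= := boolP (clear (cls a) (cls b) s); last first.
  by case: ifP => _; case: ifP => _; lia.
have cu := clear_le cl _ us; have cv := clear_le cl _ vs.
rewrite !(eq_sym _ a) !(eq_sym _ b).
have [au|_] := eqVneq a u; have [bu|_] := eqVneq b u;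
have [av|_] := eqVneq a v; have [bv|_] := eqVneq b v => /=; subst;
  try lia; try by rewrite eab in euv.
Qed.

(* Each slot has one integer abscissa per pair of vertices, plus an idle one that
   keeps the bars from being degenerate when [V] is a singleton. *)
Let N := #|{: V * V}|.+1.

Definition node (s : nat) (u v : V) : nat := (s * N + index (u, v) (enum {: V * V}))%N.

(** Decodes the abscissas of [node]. The last one of each slot overruns the enumeration, and the
    default [None] makes it the idle one. *)
Definition height (w : V) (k : nat) : nat :=
  spike_height w (k %/ N) (nth None (map some (enum {: V * V})) (k %% N)).

Lemma index_lt (u v : V) : (index (u, v) (enum {: V * V}) < #|{: V * V}|)%N.
Proof. by rewrite cardE index_mem mem_enum. Qed.

Lemma node_lt s u v : (s < L)%N -> (node s u v < L * N)%N.
Proof. by have := index_lt u v; rewrite /node /N => ? ?; nia. Qed.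

Lemma height_node w s u v :
  height w (node s u v) = spike_height w s (Some (u, v)).
Proof.
have lt := index_lt u v.
rewrite /height /node divnMDl // divn_small ?addn0; last by rewrite ltnW.
rewrite modnMDl modn_small; last by rewrite ltnW.
by rewrite (nth_map (u, v)) -?cardE // nth_index // mem_enum.
Qed.

Definition bar_start c : R := (lo c * N)%:R.
Definition bar_end c : R := (hi c * N + N.-1)%:R.

Definition bar (w : V) : set (R * R) :=
  graph_on (interp (L * N) (height w)) (bar_start (cls w)) (bar_end (cls w)).

Hypothesis lo_le_hi : forall v, (lo (cls v) <= hi (cls v))%N.
Hypothesis hi_lt : forall v, (hi (cls v) < L)%N.

Lemma bar_is_curve w : is_curve (bar w).
Proof.
apply: graph_on_is_curve; first exact: continuous_interp.
have := lo_le_hi w; rewrite /bar_start /bar_end ltr_nat /N /=.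
have : (0 < #|{: V * V}|)%N by apply/card_gt0P; exists (w, w).
nia.
Qed.

Lemma mem_bar_node w s u v y : active (cls w) s ->
  bar w ((node s u v)%:R, y) <-> y = (spike_height w s (Some (u, v)))%:R.
Proof.
move=> /andP[ls sh]; rewrite /bar /graph_on /=.
have lt := index_lt u v.
have -> : bar_start (cls w) <= (node s u v)%:R <= bar_end (cls w).
  by rewrite !ler_nat /node /N /=; apply/andP; split; nia.
rewrite interp_nat; last by rewrite node_lt // (leq_ltn_trans sh).
by rewrite height_node; split=> [[]|].
Qed.

Lemma bar_disjoint u v :
  (cls u < cls v)%N -> ~~ e u v -> bar u `&` bar v = set0.
Proof.
move=> uv euv; apply/seteqP; split => // -[x y] [].
rewrite /bar /graph_on /= => -[/andP[ux xu] yu] [/andP[vx xv] yv].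
(* Bars end at integers, so every node that has weight at [x] lies in a slot spanned by the bar. *)
have act w k : bar_start (cls w) <= x -> x <= bar_end (cls w) ->
    `|x - k%:R| < 1 -> active (cls w) (k %/ N).
  rewrite /bar_start /bar_end ltr_norml ltrBlDr ltrBrDl nat1r => a b /andP[c d].
  have : (lo (cls w) * N < k.+1)%N by rewrite -(ltr_nat R) (le_lt_trans a).
  have : (k < (hi (cls w) * N + N.-1).+1)%N.
    by rewrite -(ltr_nat R) -natr1; lra.
  rewrite !ltnS /active => kh lk; rewrite leq_divRL // lk andTb.
  by rewrite -ltnS ltn_divLR //; move: kh; rewrite /N /=; lia.
have : interp (L * N) (height u) x < interp (L * N) (height v) x.
  apply: lt_interp.
  - by apply: le_trans ux; rewrite /bar_start.
  - apply: le_lt_trans xu _; rewrite ltr_nat /N /=.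
    have := hi_lt u; nia.
  - by move=> k xk; apply: spike_height_lt; rewrite // act.
by rewrite -yu -yv ltxx.
Qed.

Theorem bar_visibility_string_graph
    (e_sym : symmetric e)
    (cls_clique : forall u v, u != v -> cls u = cls v -> e u v)
    (visible : forall u v, e u v -> (cls u < cls v)%N ->
       exists s, [/\ active (cls u) s, active (cls v) s &
                     clear (cls u) (cls v) s]) :
  is_string_graph R e.
Proof.
have actlo w : active (cls w) (lo (cls w)) by rewrite /active leqnn lo_le_hi.
exists (range bar), bar; split.
- exact: finite_image.
- by move=> _ [w _ <-]; exact: bar_is_curve.
- split => [w _ | u v _ _ uv | _ [w _ <-]]; [by exists w | | by exists w].
  apply/eqP; apply: contraT => nuv.
  (* At the node of [(u, u)], [u] is at height 1 modulo 4, while [v] would be at a multiple of 4. *)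
  pose y : R := (spike_height u (lo (cls u)) (Some (u, u)))%:R.
  have [_ /(_ erefl)] := mem_bar_node u u y (actlo u).
  rewrite uv => -[_ /=].
  rewrite interp_nat ?node_lt ?(leq_ltn_trans (lo_le_hi u)) // height_node.
  move=> /eqP; rewrite eqr_nat /spike_height !eqxx ltnn /= (negbTE nuv) /=.
  lia.
- wlog uv : / forall u v, (cls u <= cls v)%N -> u != v ->
      (e u v <-> bar u `&` bar v !=set0).
    apply=> u v; rewrite leq_eqVlt => /predU1P[cuv|cuv] nuv.
      split=> [_|_]; last exact: cls_clique.
      (* Spikes need [cls u < cls v], so at this node both curves run along their common bar. *)
      exists ((node (lo (cls u)) u v)%:R, (4 * cls u)%:R).
      split; apply/mem_bar_node; rewrite -?cuv // /spike_height cuv ltnn.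
        by rewrite (eq_sym v) (negbTE nuv) andbF.
      by rewrite (negbTE nuv).
    split=> [euv|ne]; last first.
      by apply: contraT => euv; move: ne; rewrite bar_disjoint // => -[].
    have [s [us vs cl]] := visible _ _ euv cuv.
    (* The tips of the two spikes reserved for [(u, v)]. *)
    exists ((node s u v)%:R, (2 * (cls u + cls v))%:R).
    split; apply/mem_bar_node => //; rewrite /spike_height cuv euv cl !inE !eqxx.
      by rewrite (eq_sym v) (negbTE nuv).
    by rewrite (negbTE nuv) orbT.
  move=> u v nuv; case/orP: (leq_total (cls u) (cls v)) => cuv; first exact: uv.
  by rewrite setIC e_sym; apply: uv => //; rewrite eq_sym.
Qed.
End BarVisibility.

(** * Layout of the five bars *)

Theorem theorem2 (R : realType) (V : finType) (e : rel V)
    (e_sym : symmetric e) (e_irr : irreflexive e)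
    (P : 'I_4 -> {set V}) (P_part : is_partition P)
    (P_clique : forall i : 'I_4, i != ord_max -> is_clique e (P i))
    (P_split : exists A B : {set V},
       [/\ (A :|: B)%SET = P ord_max, [disjoint A & B],
           is_clique e A, is_clique e B &
           {in A & B, forall u v, ~~ e u v}]) :
  is_string_graph R e.
Proof.
have [A [B [AB dAB clA clB nAB]]] := P_split.
pose p0 : 'I_4 := inord 0; pose p1 : 'I_4 := inord 1; pose p2 : 'I_4 := inord 2.
(* Listed by increasing height of the bars, so [A] and [B] get the indices 1 and 2. *)
pose parts := [:: P p0; A; B; P p1; P p2].
have parts_cover v : has (fun D : {set V} => v \in D) parts.
  have [i vi] := P_part.2 v; rewrite /parts /=.
  have [i3|] := eqVneq i ord_max.
    by move: vi; rewrite i3 -AB inE => /orP[->|->]; rewrite ?orbT.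
  move: vi; have -> : i = inord i by rewrite inord_val.
  case: i => [[|[|[|[|//]]]]] /= _ vi; rewrite -?val_eqE ?vi ?orbT //=.
  by rewrite inordK.
pose cls v := find (fun D : {set V} => v \in D) parts.
have cls_lt v : (cls v < 5)%N by have := parts_cover v; rewrite has_find.
have cls_in v : v \in nth finset.set0 parts (cls v).
  exact: (nth_find finset.set0 (parts_cover v)).
(* Lines of sight: 0-4 in slot 0; 0-1 and 1-4 in slot 1; 1-3 in slot 2; 0-3 and 3-4 in slot 3; 2-3
   in slot 4; 0-2 and 2-4 in slot 5. *)
pose lo := nth 0%N [:: 0; 1; 4; 2; 0]%N; pose hi := nth 0%N [:: 5; 2; 5; 4; 5]%N.
have parts_clique c : (c < 5)%N -> is_clique e (nth finset.set0 parts c).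
  have ne (k : nat) : (k < 3)%N -> (inord k : 'I_4) != ord_max.
    by move=> k3; rewrite -val_eqE /= inordK; lia.
  by case: c => [|[|[|[|[|//]]]]] _ //=; apply: P_clique; exact: ne.
apply: (@bar_visibility_string_graph R V e cls lo hi 6) => //.
- by move=> v; case: (cls v) (cls_lt v) => [|[|[|[|[|//]]]]].
- by move=> v; case: (cls v) (cls_lt v) => [|[|[|[|[|//]]]]].
- move=> u v nuv cuv; apply: (parts_clique _ (cls_lt u) _ _ (cls_in u) _ nuv).
  by rewrite cuv; exact: cls_in.
move=> u v euv cuv.
have n12 : ~~ ((cls u == 1) && (cls v == 2))%N.
  apply/negP => /andP[/eqP u1 /eqP v2].
  have := cls_in u; have := cls_in v; rewrite u1 v2 /= => vB uA.
  by have := nAB u v uA vB; rewrite euv.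
(* A finite computation finds a slot for each of the nine pairs other than 1-2. *)
have seen : all (fun c => all (fun d => [|| (d <= c)%N, (c == 1) && (d == 2) |
    has (fun s => [&& active lo hi c s, active lo hi d s & clear lo hi c d s])
      (iota 0 6)]) (iota 0 5)) (iota 0 5) by [].
have := allP (allP seen (cls u) _) (cls v); rewrite !mem_iota !cls_lt => /(_ isT isT).
rewrite leqNgt cuv (negbTE n12) !orFb => /hasP[s _ /and3P[us vs cl]].
by exists s.
Qed.
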